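(* Let $E$ be a directed graph with finitely many vertices, let $K$ be a field, and let $\Gamma$ be the infinite cyclic group generated by $x$. The following conditions are equivalent. (1) $L_K(E)$, with its natural $\mathbb{Z}$-grading, is strongly graded. (2) $1_E$ is a strong order-unit of $M_E^\Gamma$ (equivalently, of $G_E^\Gamma$). (3) $E$ is a row-finite graph with no sinks.
   Context: **Graphs.** A directed graph $E$ has vertex set $E^0$, edge set $E^1$, source map $\mathbf{s}$ and range map $\mathbf{r}$. $E$ is row-finite if $\mathbf{s}^{-1}(v)$ is finite for every $v\in E^0$. A vertex $v$ is a sink if $\mathbf{s}^{-1}(v)=\emptyset$, regular if $\mathbf{s}^{-1}(v)$ is finite and nonempty, and an infinite emitter if $\mathbf{s}^{-1}(v)$ is infinite. **Leavitt path algebra.** $L_K(E)$ is the free $K$-algebra generated by $E^0\cup E^1\cup\{e^*\mid e\in E^1\}$ subject to, for all vertices $v,w$ and edges $e,f$: $vw=0$ if $v\ne w$ and $vv=v$; $\mathbf{s}(e)e=e\mathbf{r}(e)=e$; $\mathbf{r}(e)e^*=e^*\mathbf{s}(e)=e^*$; $e^*f=0$ if $e\neq f$ and $e^*e=\mathbf{r}(e)$; $v=\sum_{e\in\mathbf{s}^{-1}(v)}ee^*$ for each regular vertex $v$. Its natural $\mathbb{Z}$-grading has $n$-component the $K$-span of all $pq^*$ with $p,q$ paths and $|p|-|q|=n$, where $|p|$ is the length of $p$. A $\Gamma$-graded ring $R=\bigoplus_\gamma R_\gamma$ is strongly graded if $R_\gamma R_\delta=R_{\gamma\delta}$ for all $\gamma,\delta$.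 **The graph monoid and group.** $F_E^\Gamma$ is the free commutative $\Gamma$-monoid generated by the vertices $v\in E^0$ and elements $q_Z$ for each finite nonempty $Z\subseteq\mathbf{s}^{-1}(v)$ where $v$ is an infinite emitter. $M_E^\Gamma$ is the quotient of $F_E^\Gamma$ by the congruence $\sim$ generated by, for all $\gamma\in\Gamma$ and $a\in F_E^\Gamma$: (A1) $a+\gamma v\to_1 a+\sum_{e\in\mathbf{s}^{-1}(v)}\gamma x\,\mathbf{r}(e)$ for $v$ regular; (A2) $a+\gamma v\to_1 a+\gamma q_Z+\sum_{e\in Z}\gamma x\,\mathbf{r}(e)$ for $v$ an infinite emitter and $Z\subseteq\mathbf{s}^{-1}(v)$ finite nonempty; (A3) $a+\gamma q_Z\to_1 a+\gamma q_W+\sum_{e\in W-Z}\gamma x\,\mathbf{r}(e)$ for $v$ an infinite emitter and $Z\subsetneq W$ finite nonempty subsets of $\mathbf{s}^{-1}(v)$. $[a]$ denotes the class of $a$, and $[a]\le[b]$ if $a+c\sim b$ for some $c\in F_E^\Gamma$. $M_E^\Gamma$ is cancellative; $G_E^\Gamma$ is its Grothendieck group (group completion) with the induced $\Gamma$-action and with positive cone the image of $M_E^\Gamma$. $1_E=\sum_{v\in E^0}[v]$. **Strong order-unit.** An element $u$ of a pre-ordered $\Gamma$-monoid or $\Gamma$-group $G$ (with $u\ge0$ in the group case) is a strong order-unit if for every $y\in G$ there is a positive integer $n$ with $y\le nu$. *)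

(* Defs.v *)
From HB Require Import structures.
From Stdlib Require Export Relations.
From mathcomp Require Export all_boot all_order all_algebra finmap multiset.
From mathcomp Require Export generic_quotient boolp classical_sets cardinality.

Set Implicit Arguments.
Unset Strict Implicit.
Unset Printing Implicit Defensive.

Import GRing.Theory.
Local Open Scope quotient_scope.
Local Open Scope classical_set_scope.
Local Open Scope ring_scope.

Record digraph := Digraph {
  vertex : finType;
  edge : choiceType;
  src : edge -> vertex;
  rng : edge -> vertex }.

Section Graph.
Variable E : digraph.

Definition out (v : vertex E) : set (edge E) := [set e | src e = v].

Definition sink (v : vertex E) := out v = set0.
Definition regular (v : vertex E) := finite_set (out v) /\ out v !=set0.
Definition infinite_emitter (v : vertex E) := infinite_set (out v).

Definition row_finite := forall v : vertex E, finite_set (out v).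

Fixpoint is_path (v : vertex E) (p : seq (edge E)) : bool :=
  if p is e :: p' then (src e == v) && is_path (rng e) p' else true.

(* A path is its source together with its list of edges; the trivial paths
   are the vertices. *)
Definition gpath := {p : vertex E * seq (edge E) | is_path p.1 p.2}.

Definition psrc (p : gpath) : vertex E := (val p).1.
Definition pedges (p : gpath) : seq (edge E) := (val p).2.
Definition plen (p : gpath) : nat := size (pedges p).

End Graph.

Section Leavitt.
Variables (K : fieldType) (E : digraph).

Inductive lpa_gen :=
  | Vertex of vertex E
  | Edge of edge E
  | Ghost of edge E.

(* Formal (not necessarily unital) K-algebra expressions in the generators. *)
Inductive lpa_expr :=
  | XGen of lpa_gen
  | XZero
  | XAdd of lpa_expr & lpa_expr
  | XScale of K & lpa_expr
  | XMul of lpa_expr & lpa_expr.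

(* The least congruence containing the axioms of associative K-algebras (without
   unit) and the defining relations; the quotient is the K-algebra presented by
   these generators and relations. *)
Inductive lpa_eq : lpa_expr -> lpa_expr -> Prop :=
  | lpa_refl a : lpa_eq a a
  | lpa_sym a b : lpa_eq a b -> lpa_eq b a
  | lpa_trans a b c : lpa_eq a b -> lpa_eq b c -> lpa_eq a c
  | lpa_congD a a' b b' :
      lpa_eq a a' -> lpa_eq b b' -> lpa_eq (XAdd a b) (XAdd a' b')
  | lpa_congZ k a a' : lpa_eq a a' -> lpa_eq (XScale k a) (XScale k a')
  | lpa_congM a a' b b' :
      lpa_eq a a' -> lpa_eq b b' -> lpa_eq (XMul a b) (XMul a' b')
  | lpa_addA a b c : lpa_eq (XAdd a (XAdd b c)) (XAdd (XAdd a b) c)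
  | lpa_addC a b : lpa_eq (XAdd a b) (XAdd b a)
  | lpa_add0 a : lpa_eq (XAdd XZero a) a
  | lpa_scaleA k l a : lpa_eq (XScale k (XScale l a)) (XScale (k * l) a)
  | lpa_scale0 a : lpa_eq (XScale 0 a) XZero
  | lpa_scale1 a : lpa_eq (XScale 1 a) a
  | lpa_scaleDr k a b :
      lpa_eq (XScale k (XAdd a b)) (XAdd (XScale k a) (XScale k b))
  | lpa_scaleDl k l a :
      lpa_eq (XScale (k + l) a) (XAdd (XScale k a) (XScale l a))
  | lpa_mulA a b c : lpa_eq (XMul a (XMul b c)) (XMul (XMul a b) c)
  | lpa_mulDl a b c : lpa_eq (XMul (XAdd a b) c) (XAdd (XMul a c) (XMul b c))
  | lpa_mulDr a b c : lpa_eq (XMul a (XAdd b c)) (XAdd (XMul a b) (XMul a c))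
  | lpa_scaleAl k a b : lpa_eq (XMul (XScale k a) b) (XScale k (XMul a b))
  | lpa_scaleAr k a b : lpa_eq (XMul a (XScale k b)) (XScale k (XMul a b))
  | lpa_vv v : lpa_eq (XMul (XGen (Vertex v)) (XGen (Vertex v)))
                      (XGen (Vertex v))
  | lpa_vw v w : v <> w ->
      lpa_eq (XMul (XGen (Vertex v)) (XGen (Vertex w))) XZero
  | lpa_src_edge e :
      lpa_eq (XMul (XGen (Vertex (src e))) (XGen (Edge e))) (XGen (Edge e))
  | lpa_edge_rng e :
      lpa_eq (XMul (XGen (Edge e)) (XGen (Vertex (rng e)))) (XGen (Edge e))
  | lpa_rng_ghost e :
      lpa_eq (XMul (XGen (Vertex (rng e))) (XGen (Ghost e))) (XGen (Ghost e))
  | lpa_ghost_src e :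
      lpa_eq (XMul (XGen (Ghost e)) (XGen (Vertex (src e)))) (XGen (Ghost e))
  | lpa_ghost_edge e :
      lpa_eq (XMul (XGen (Ghost e)) (XGen (Edge e))) (XGen (Vertex (rng e)))
  | lpa_ghost_edge_neq e f : e <> f ->
      lpa_eq (XMul (XGen (Ghost e)) (XGen (Edge f))) XZero
  | lpa_regular v : regular v ->
      lpa_eq (XGen (Vertex v))
             (\big[XAdd/XZero]_(e <- fset_set (out v))
                XMul (XGen (Edge e)) (XGen (Ghost e))).

HB.instance Definition _ := gen_eqMixin lpa_expr.
HB.instance Definition _ := gen_choiceMixin lpa_expr.

Definition lpa_rel (a b : lpa_expr) : bool := `[< lpa_eq a b >].

Lemma lpa_rel_refl : reflexive lpa_rel.
Proof. by move=> a; apply/asboolP/lpa_refl. Qed.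

Lemma lpa_rel_sym : symmetric lpa_rel.
Proof. by move=> a b; apply/asboolP/asboolP => /lpa_sym. Qed.

Lemma lpa_rel_trans : transitive lpa_rel.
Proof.
by move=> b a c /asboolP ab /asboolP bc; apply/asboolP/(lpa_trans ab bc).
Qed.

Canonical lpa_equiv := EquivRel lpa_rel lpa_rel_refl lpa_rel_sym lpa_rel_trans.

Definition LPA := {eq_quot lpa_equiv}.
HB.instance Definition _ := Choice.on LPA.
HB.instance Definition _ := EqQuotient.on LPA.

Definition lpa_class (a : lpa_expr) : LPA := \pi_LPA a.

Lemma lpa_classP a b : lpa_class a = lpa_class b <-> lpa_eq a b.
Proof.
split=> [/eqP|ab]; first by rewrite eqmodE => /asboolP.
by apply/eqP; rewrite eqmodE; apply/asboolP.
Qed.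

Lemma lpa_classK (x : LPA) : lpa_class (repr x) = x.
Proof. exact: reprK. Qed.

Lemma lpa_repr a : lpa_eq (repr (lpa_class a)) a.
Proof. by apply/lpa_classP; rewrite lpa_classK. Qed.

Definition lpa_zero : LPA := lpa_class XZero.
Definition lpa_add (x y : LPA) : LPA := lpa_class (XAdd (repr x) (repr y)).
Definition lpa_scale (k : K) (x : LPA) : LPA := lpa_class (XScale k (repr x)).
Definition lpa_opp (x : LPA) : LPA := lpa_scale (-1) x.
Definition lpa_mul (x y : LPA) : LPA := lpa_class (XMul (repr x) (repr y)).

Lemma lpa_class_add a b :
  lpa_class (XAdd a b) = lpa_add (lpa_class a) (lpa_class b).
Proof. by apply/lpa_classP/lpa_congD; apply/lpa_sym/lpa_repr. Qed.

Lemma lpa_class_scale k a :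
  lpa_class (XScale k a) = lpa_scale k (lpa_class a).
Proof. by apply/lpa_classP/lpa_congZ/lpa_sym/lpa_repr. Qed.

Lemma lpa_class_mul a b :
  lpa_class (XMul a b) = lpa_mul (lpa_class a) (lpa_class b).
Proof. by apply/lpa_classP/lpa_congM; apply/lpa_sym/lpa_repr. Qed.

Lemma lpa_ind (P : LPA -> Prop) : (forall a, P (lpa_class a)) -> forall x, P x.
Proof. by move=> Pc x; rewrite -(lpa_classK x). Qed.

Fact lpa_add_assoc : associative lpa_add.
Proof.
elim/lpa_ind=> a; elim/lpa_ind=> b; elim/lpa_ind=> c.
by rewrite -!lpa_class_add; apply/lpa_classP/lpa_addA.
Qed.

Fact lpa_add_comm : commutative lpa_add.
Proof.
elim/lpa_ind=> a; elim/lpa_ind=> b.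
by rewrite -!lpa_class_add; apply/lpa_classP/lpa_addC.
Qed.

Fact lpa_add_zero : left_id lpa_zero lpa_add.
Proof.
elim/lpa_ind=> a.
by rewrite -!lpa_class_add; apply/lpa_classP/lpa_add0.
Qed.

Fact lpa_add_opp : left_inverse lpa_zero lpa_opp lpa_add.
Proof.
elim/lpa_ind=> a; rewrite /lpa_opp -lpa_class_scale -lpa_class_add.
apply/lpa_classP/(lpa_trans _ (lpa_scale0 a)); rewrite -(addNr 1).
apply/lpa_sym/(lpa_trans (lpa_scaleDl _ _ _))/lpa_congD.
  exact: lpa_refl.
exact: lpa_scale1.
Qed.

HB.instance Definition _ := GRing.isZmodule.Build LPA
  lpa_add_assoc lpa_add_comm lpa_add_zero lpa_add_opp.

Lemma lpa_classD a b : lpa_class (XAdd a b) = lpa_class a + lpa_class b.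
Proof. exact: lpa_class_add. Qed.

Fact lpa_scale_assoc k l x : lpa_scale k (lpa_scale l x) = lpa_scale (k * l) x.
Proof.
by elim/lpa_ind: x => a; rewrite -!lpa_class_scale; apply/lpa_classP/lpa_scaleA.
Qed.

Fact lpa_scale_one : left_id 1 lpa_scale.
Proof.
by elim/lpa_ind=> a; rewrite -lpa_class_scale; apply/lpa_classP/lpa_scale1.
Qed.

Fact lpa_scale_addr : right_distributive lpa_scale +%R.
Proof.
move=> k; elim/lpa_ind=> a; elim/lpa_ind=> b.
by rewrite -lpa_classD -!lpa_class_scale -lpa_classD;
  apply/lpa_classP/lpa_scaleDr.
Qed.

Fact lpa_scale_addl x : {morph lpa_scale^~ x : k l / k + l}.
Proof.
elim/lpa_ind: x => a k l.
by rewrite -!lpa_class_scale -lpa_classD; apply/lpa_classP/lpa_scaleDl.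
Qed.

HB.instance Definition _ := GRing.Zmodule_isLmodule.Build K LPA
  lpa_scale_assoc lpa_scale_one lpa_scale_addr lpa_scale_addl.

Lemma lpa_classZ k a : lpa_class (XScale k a) = k *: lpa_class a.
Proof. exact: lpa_class_scale. Qed.

Definition lpa_v (v : vertex E) : LPA := lpa_class (XGen (Vertex v)).
Definition lpa_e (e : edge E) : LPA := lpa_class (XGen (Edge e)).
Definition lpa_g (e : edge E) : LPA := lpa_class (XGen (Ghost e)).

(* As the vertex set is finite, the sum of the vertices is a unit. *)
Definition lpa_one : LPA := \sum_(v : vertex E) lpa_v v.

Fact lpa_mul_addl : left_distributive lpa_mul +%R.
Proof.
elim/lpa_ind=> a; elim/lpa_ind=> b; elim/lpa_ind=> c.
by rewrite -lpa_classD -!lpa_class_mul -lpa_classD;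
  apply/lpa_classP/lpa_mulDl.
Qed.

Fact lpa_mul_addr : right_distributive lpa_mul +%R.
Proof.
elim/lpa_ind=> a; elim/lpa_ind=> b; elim/lpa_ind=> c.
by rewrite -lpa_classD -!lpa_class_mul -lpa_classD;
  apply/lpa_classP/lpa_mulDr.
Qed.

Fact lpa_mul_assoc : associative lpa_mul.
Proof.
elim/lpa_ind=> a; elim/lpa_ind=> b; elim/lpa_ind=> c.
by rewrite -!lpa_class_mul; apply/lpa_classP/lpa_mulA.
Qed.

Fact lpa_mul_scalel k (x y : LPA) : lpa_mul (k *: x) y = k *: lpa_mul x y.
Proof.
elim/lpa_ind: x => a; elim/lpa_ind: y => b.
by rewrite -lpa_classZ -!lpa_class_mul -lpa_classZ;
  apply/lpa_classP/lpa_scaleAl.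
Qed.

Fact lpa_mul_scaler k (x y : LPA) : lpa_mul x (k *: y) = k *: lpa_mul x y.
Proof.
elim/lpa_ind: x => a; elim/lpa_ind: y => b.
by rewrite -lpa_classZ -!lpa_class_mul -lpa_classZ;
  apply/lpa_classP/lpa_scaleAr.
Qed.

Fact lpa_mul0x x : lpa_mul 0 x = 0.
Proof. by apply: (addIr (lpa_mul 0 x)); rewrite -lpa_mul_addl !add0r. Qed.

Fact lpa_mulx0 x : lpa_mul x 0 = 0.
Proof. by apply: (addIr (lpa_mul x 0)); rewrite -lpa_mul_addr !add0r. Qed.

Fact lpa_one_mul x : lpa_mul lpa_one x = \sum_v lpa_mul (lpa_v v) x.
Proof.
by apply: (big_morph (lpa_mul^~ x)) => [y z|]; rewrite ?lpa_mul_addl ?lpa_mul0x.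
Qed.

Fact lpa_mul_one x : lpa_mul x lpa_one = \sum_v lpa_mul x (lpa_v v).
Proof.
by apply: (big_morph (lpa_mul x)) => [y z|]; rewrite ?lpa_mul_addr ?lpa_mulx0.
Qed.

Fact lpa_vertM v w : lpa_mul (lpa_v v) (lpa_v w) = if v == w then lpa_v v else 0.
Proof.
rewrite -lpa_class_mul; case: eqP => [<-|neq]; apply/lpa_classP.
  exact: lpa_vv.
exact: lpa_vw.
Qed.

Fact lpa_one_mul_v v : lpa_mul lpa_one (lpa_v v) = lpa_v v.
Proof.
rewrite lpa_one_mul (bigD1 v) //= lpa_vertM eqxx big1 ?addr0 // => w wv.
by rewrite lpa_vertM (negbTE wv).
Qed.

Fact lpa_mul_v_one v : lpa_mul (lpa_v v) lpa_one = lpa_v v.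
Proof.
rewrite lpa_mul_one (bigD1 v) //= lpa_vertM eqxx big1 ?addr0 // => w wv.
by rewrite lpa_vertM eq_sym (negbTE wv).
Qed.

Fact lpa_mul_onel : left_id lpa_one lpa_mul.
Proof.
have via v y : lpa_mul (lpa_v v) y = y -> lpa_mul lpa_one y = y.
  by move=> <-; rewrite lpa_mul_assoc lpa_one_mul_v.
elim/lpa_ind; elim=> [[v|e|e]||a IHa b IHb|k a IHa|a IHa b IHb].
- exact: lpa_one_mul_v.
- by apply: (via (src e)); rewrite -lpa_class_mul;
    apply/lpa_classP/lpa_src_edge.
- by apply: (via (rng e)); rewrite -lpa_class_mul;
    apply/lpa_classP/lpa_rng_ghost.
- exact: lpa_mulx0.
- by rewrite lpa_classD lpa_mul_addr IHa IHb.
- by rewrite lpa_classZ lpa_mul_scaler IHa.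
- by rewrite lpa_class_mul lpa_mul_assoc IHa.
Qed.

Fact lpa_mul_oner : right_id lpa_one lpa_mul.
Proof.
have via v y : lpa_mul y (lpa_v v) = y -> lpa_mul y lpa_one = y.
  by move=> <-; rewrite -lpa_mul_assoc lpa_mul_v_one.
elim/lpa_ind; elim=> [[v|e|e]||a IHa b IHb|k a IHa|a IHa b IHb].
- exact: lpa_mul_v_one.
- by apply: (via (rng e)); rewrite -lpa_class_mul;
    apply/lpa_classP/lpa_edge_rng.
- by apply: (via (src e)); rewrite -lpa_class_mul;
    apply/lpa_classP/lpa_ghost_src.
- exact: lpa_mul0x.
- by rewrite lpa_classD lpa_mul_addl IHa IHb.
- by rewrite lpa_classZ lpa_mul_scalel IHa.
- by rewrite lpa_class_mul -lpa_mul_assoc IHb.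
Qed.

(* Only a [pzRingType]: the algebra of the empty graph is the zero ring. *)
HB.instance Definition _ := GRing.Zmodule_isPzRing.Build LPA
  lpa_mul_assoc lpa_mul_onel lpa_mul_oner lpa_mul_addl lpa_mul_addr.

Lemma lpa_classM a b : lpa_class (XMul a b) = lpa_class a * lpa_class b.
Proof. exact: lpa_class_mul. Qed.

Lemma lpa_scalerAl k (x y : LPA) : k *: (x * y) = (k *: x) * y.
Proof. exact/esym/lpa_mul_scalel. Qed.

Lemma lpa_scalerAr k (x y : LPA) : k *: (x * y) = x * (k *: y).
Proof. exact/esym/lpa_mul_scaler. Qed.

Definition lpa_path (p : gpath E) : LPA :=
  lpa_v (psrc p) * \prod_(e <- pedges p) lpa_e e.

Definition lpa_path_ghost (q : gpath E) : LPA :=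
  (\prod_(e <- rev (pedges q)) lpa_g e) * lpa_v (psrc q).

Definition lpa_component (n : int) : set LPA :=
  [set z | exists2 s : seq (K * (gpath E * gpath E)),
     {in s, forall t, (plen t.2.1)%:Z - (plen t.2.2)%:Z = n} &
     z = \sum_(t <- s) t.1 *: (lpa_path t.2.1 * lpa_path_ghost t.2.2)].

End Leavitt.

Section Graded.
Variables (D : zmodType) (R : pzRingType).

(* The additive subgroup generated by the products, when A and B are additive
   subgroups of R. *)
Definition prod_set (A B : set R) : set R :=
  [set z | exists2 s : seq (R * R),
     {in s, forall t, A t.1 /\ B t.2} & z = \sum_(t <- s) t.1 * t.2].

Definition graded (C : D -> set R) : Prop :=
  [/\ forall d, C d 0 /\ forall x y, C d x -> C d y -> C d (x - y),
      forall d d', prod_set (C d) (C d') `<=` C (d + d'),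
      forall r, exists (s : seq D) (f : D -> R),
        (forall d, C d (f d)) /\ r = \sum_(d <- s) f d
    & forall (s : seq D) (f : D -> R), uniq s -> (forall d, C d (f d)) ->
        \sum_(d <- s) f d = 0 -> {in s, forall d, f d = 0}].

Definition strongly_graded (C : D -> set R) : Prop :=
  graded C /\ forall d d', prod_set (C d) (C d') = C (d + d').

End Graded.

Definition strong_order_unit (M : nmodType) (le : M -> M -> Prop) (u : M) :=
  forall y : M, exists2 n : nat, (0 < n)%N & le y (u *+ n).

Definition group_strong_order_unit (G : zmodType) (le : G -> G -> Prop)
  (u : G) := le 0 u /\ strong_order_unit le u.

Section Grothendieck.
Variable M : nmodType.

Definition groth_rel (a b : M * M) : bool :=
  `[< exists c, a.1 + b.2 + c = b.1 + a.2 + c >].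

Lemma groth_rel_refl : reflexive groth_rel.
Proof. by move=> a; apply/asboolP; exists 0. Qed.

Lemma groth_rel_sym : symmetric groth_rel.
Proof. by move=> a b; apply/asboolP/asboolP => -[c ec]; exists c. Qed.

Lemma groth_rel_trans : transitive groth_rel.
Proof.
move=> b a c /asboolP[d ed] /asboolP[d' ed']; apply/asboolP.
exists (b.1 + b.2 + d + d').
rewrite (AC (2*4) ((1*4*5)*(3*2*6))) /= ed ed'.
by rewrite (AC (3*3) ((4*2)*(1*5*3*6))).
Qed.

Canonical groth_equiv :=
  EquivRel groth_rel groth_rel_refl groth_rel_sym groth_rel_trans.

Definition groth := {eq_quot groth_equiv}.
HB.instance Definition _ := Choice.on groth.
HB.instance Definition _ := EqQuotient.on groth.


Definition groth_pair (m n : M) : groth := \pi_groth (m, n).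
Definition groth_pos (m : M) : groth := groth_pair m 0.

Lemma groth_pairP m n m' n' :
  groth_pair m n = groth_pair m' n' <-> exists c, m + n' + c = m' + n + c.
Proof.
split=> [/eqP|ex]; first by rewrite eqmodE => /asboolP.
by apply/eqP; rewrite eqmodE; apply/asboolP.
Qed.

Lemma groth_ind (P : groth -> Prop) :
  (forall m n, P (groth_pair m n)) -> forall x, P x.
Proof. by move=> Pp x; rewrite -[x]reprK; case: (repr x). Qed.

Definition groth_zero : groth := groth_pos 0.
Definition groth_add (x y : groth) : groth :=
  groth_pair ((repr x).1 + (repr y).1) ((repr x).2 + (repr y).2).
Definition groth_opp (x : groth) : groth := groth_pair (repr x).2 (repr x).1.

Lemma groth_repr m n :
  exists c, (repr (groth_pair m n)).1 + n + c
          = m + (repr (groth_pair m n)).2 + c.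
Proof.
by apply/groth_pairP; rewrite /groth_pair -surjective_pairing reprK.
Qed.

Lemma groth_pair_add m n m' n' :
  groth_add (groth_pair m n) (groth_pair m' n') = groth_pair (m + m') (n + n').
Proof.
rewrite /groth_add; apply/groth_pairP.
have [c ec] := groth_repr m n; have [d ed] := groth_repr m' n'; exists (c + d).
by rewrite (AC (2*2*2) ((1*3*5)*(2*4*6))) /= ec ed (AC (3*3) (1*4*(2*5)*(3*6))).
Qed.

Lemma groth_pair_opp m n : groth_opp (groth_pair m n) = groth_pair n m.
Proof.
apply/groth_pairP; have [c ec] := groth_repr m n; exists c.
by rewrite [_ + m]addrC -ec [_ + n]addrC.
Qed.

Fact groth_addA : associative groth_add.
Proof.
elim/groth_ind=> a a'; elim/groth_ind=> b b'; elim/groth_ind=> c c'.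
by rewrite !groth_pair_add !addrA.
Qed.

Fact groth_addC : commutative groth_add.
Proof.
elim/groth_ind=> a a'; elim/groth_ind=> b b'.
by rewrite !groth_pair_add (addrC a) (addrC a').
Qed.

Fact groth_add0 : left_id groth_zero groth_add.
Proof. by elim/groth_ind=> a a'; rewrite groth_pair_add !add0r. Qed.

Fact groth_addN : left_inverse groth_zero groth_opp groth_add.
Proof.
elim/groth_ind=> a a'; rewrite groth_pair_opp groth_pair_add.
by apply/groth_pairP; exists 0; rewrite !addr0 add0r addrC.
Qed.

HB.instance Definition _ := GRing.isZmodule.Build groth
  groth_addA groth_addC groth_add0 groth_addN.

Lemma groth_pairD m n m' n' :
  groth_pair m n + groth_pair m' n' = groth_pair (m + m') (n + n').
Proof. exact: groth_pair_add. Qed.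

Lemma groth_pairN m n : - groth_pair m n = groth_pair n m.
Proof. exact: groth_pair_opp. Qed.

(* The positive cone is the image of M. *)
Definition groth_le (x y : groth) : Prop := exists m : M, y - x = groth_pos m.

End Grothendieck.

Section GraphMonoid.
Variables (Gam : groupType) (x : Gam) (E : digraph).

(* The index sets Z of the generators q_Z with Z a set of edges emitted by v;
   this type is empty unless v is an infinite emitter. *)
Definition qset (v : vertex E) :=
  {Z : {fset edge E} |
    `[< [/\ infinite_emitter v, Z != fset0 & [set` Z] `<=` out v] >]}.

(* The right summand stands for the symbols q_Z. *)
Definition fgen := (vertex E + {v : vertex E & qset v})%type.

(* The free commutative Gam-monoid on [fgen] is the free commutative monoid on
   Gam * fgen, where Gam acts by translation on the first component. *)
Definition FM := {mset (Gam * fgen)}%mset.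
HB.instance Definition _ := Choice.on FM.

Fact FM_addA : associative (@msetD (Gam * fgen)%type : FM -> FM -> FM).
Proof. by move=> a b c; rewrite msetDA. Qed.

Fact FM_addC : commutative (@msetD (Gam * fgen)%type : FM -> FM -> FM).
Proof. by move=> a b; rewrite msetDC. Qed.

Fact FM_add0 : left_id (mset0 : FM) (@msetD (Gam * fgen)%type).
Proof. by move=> a; rewrite mset0D. Qed.

HB.instance Definition _ := GRing.isNmodule.Build FM FM_addA FM_addC FM_add0.

Definition Fv (g : Gam) (v : vertex E) : FM := [mset (g, inl v)]%mset.
Definition Fq (g : Gam) (v : vertex E) (Z : qset v) : FM :=
  [mset (g, inr (Tagged qset Z))]%mset.

Inductive FM_step : FM -> FM -> Prop :=
  | FM_A1 (a : FM) g v : regular v ->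
      FM_step (a + Fv g v)
              (a + \sum_(e <- fset_set (out v)) Fv (g * x)%g (rng e))
  | FM_A2 (a : FM) g v (Z : qset v) :
      FM_step (a + Fv g v)
              (a + Fq g Z + \sum_(e <- val Z) Fv (g * x)%g (rng e))
  | FM_A3 (a : FM) g v (Z W : qset v) : (val Z `<` val W)%fset ->
      FM_step (a + Fq g Z)
              (a + Fq g W
                 + \sum_(e <- (val W `\` val Z)%fset) Fv (g * x)%g (rng e)).

(* [FM_step] is closed under addition and under the action of Gam, hence the
   congruence it generates is its equivalence closure. *)
Definition FM_rel (a b : FM) : bool := `[< clos_refl_sym_trans FM FM_step a b >].

Lemma FM_rel_refl : reflexive FM_rel.
Proof. by move=> a; apply/asboolP/rst_refl. Qed.

Lemma FM_rel_sym : symmetric FM_rel.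
Proof. by move=> a b; apply/asboolP/asboolP; apply: rst_sym. Qed.

Lemma FM_rel_trans : transitive FM_rel.
Proof.
by move=> b a c /asboolP ab /asboolP bc; apply/asboolP/(rst_trans _ _ _ _ _ ab bc).
Qed.

Canonical FM_equiv := EquivRel FM_rel FM_rel_refl FM_rel_sym FM_rel_trans.

Definition ME := {eq_quot FM_equiv}.
HB.instance Definition _ := Choice.on ME.
HB.instance Definition _ := EqQuotient.on ME.

Definition ME_class (a : FM) : ME := \pi_ME a.

Lemma ME_classP a b :
  ME_class a = ME_class b <-> clos_refl_sym_trans FM FM_step a b.
Proof.
split=> [/eqP|ab]; first by rewrite eqmodE => /asboolP.
by apply/eqP; rewrite eqmodE; apply/asboolP.
Qed.

Lemma ME_repr a : clos_refl_sym_trans FM FM_step (repr (ME_class a)) a.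
Proof. by apply/ME_classP; rewrite /ME_class reprK. Qed.

Lemma ME_ind (P : ME -> Prop) : (forall a, P (ME_class a)) -> forall m, P m.
Proof. by move=> Pc m; rewrite -[m]reprK. Qed.

Lemma FM_stepD c a b : FM_step a b -> FM_step (c + a) (c + b).
Proof.
case=> [d g v rv|d g v Z|d g v Z W ZW]; rewrite !addrA.
- exact: FM_A1.
- exact: FM_A2.
- exact: FM_A3.
Qed.

Lemma FM_eqD a a' b b' :
  clos_refl_sym_trans FM FM_step a a' -> clos_refl_sym_trans FM FM_step b b' ->
  clos_refl_sym_trans FM FM_step (a + b) (a' + b').
Proof.
have addl c d d' : clos_refl_sym_trans FM FM_step d d' ->
    clos_refl_sym_trans FM FM_step (c + d) (c + d').
  elim=> [{}d {}d' /(FM_stepD c) dd'|{}d|{}d {}d' _ dd'|{}d e {}d' _ de _ ed'].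
  - exact: rst_step.
  - exact: rst_refl.
  - exact: rst_sym.
  - exact: rst_trans de ed'.
move=> aa' bb'; apply: (rst_trans _ _ _ (a + b')); first exact: addl.
by rewrite ![_ + b']addrC; apply: addl.
Qed.

Definition ME_add (m n : ME) : ME := ME_class (repr m + repr n).

Lemma ME_class_add a b : ME_add (ME_class a) (ME_class b) = ME_class (a + b).
Proof. by apply/ME_classP/FM_eqD; apply: ME_repr. Qed.

Fact ME_addA : associative ME_add.
Proof.
elim/ME_ind=> a; elim/ME_ind=> b; elim/ME_ind=> c.
by rewrite !ME_class_add addrA.
Qed.

Fact ME_addC : commutative ME_add.
Proof.
by elim/ME_ind=> a; elim/ME_ind=> b; rewrite !ME_class_add addrC.
Qed.

Fact ME_add0 : left_id (ME_class 0) ME_add.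
Proof. by elim/ME_ind=> a; rewrite ME_class_add add0r. Qed.

HB.instance Definition _ := GRing.isNmodule.Build ME ME_addA ME_addC ME_add0.

Lemma ME_classD a b : ME_class (a + b) = ME_class a + ME_class b.
Proof. exact/esym/ME_class_add. Qed.

Definition ME_le (m n : ME) : Prop := exists c : ME, m + c = n.

Definition ME_one : ME := \sum_(v : vertex E) ME_class (Fv 1%g v).

Definition GE := groth ME.
HB.instance Definition _ := GRing.Zmodule.on GE.

Definition GE_le : GE -> GE -> Prop := @groth_le ME.

Definition GE_one : GE := groth_pos ME_one.

End GraphMonoid.

Definition infinite_cyclic (Gam : groupType) (x : Gam) : Prop :=
  (forall g : Gam, exists n : nat, g = (x ^+ n)%g \/ g = (x ^- n)%g) /\
  (forall n : nat, (0 < n)%N -> (x ^+ n)%g <> 1%g).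

(* Main.v *)
Require Import Defs.
From mathcomp Require Import all_boot all_order all_algebra finmap multiset.
From mathcomp Require Import generic_quotient boolp classical_sets cardinality.
From mathcomp Require Import functions.
From mathcomp Require Import zify.

(** Both the grading condition and the order-unit conditions are governed by
    how a vertex at a level k (an integer) is related to its out-neighbours
    at level k + 1.

    Suppose that the graph is row-finite without sinks. A vertex v at level k
    equals, in the graph monoid, the sum of its out-neighbours at level k + 1,
    so it is dominated by a multiple of the unit if and only if they all are.
    In the algebra, write L_d for the component of degree d: by the relation v
    = sum of e e*, and by e* v e = r(e), the vertex v lies in L_{-k} L_k if and
    only if each out-neighbour lies in L_{-(k+1)} L_{k+1}. In both cases the
    property holds at level 0. That it then holds at all levels is the same
    statement about finite sets of vertices, [level_propagation]. The negative
    levels are immediate; for the positive ones, vertices at the end of long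
    paths are at the end of arbitrarily long paths.

    Conversely, let L_0 = L_1 L_{-1}. A vertex is then a finite sum of products
    whose left factors begin with an edge. For a sink the vertex would be zero,
    and for an infinite emitter the range of any edge not involved in that sum.
    But vertices are nonzero, because the algebra acts on the functions on
    boundary paths with no vertex acting by zero ([lpa_v_neq0]). That the
    components form a grading at all is also read off from an action, on
    two-sided formal series ([comp_graded]).

    Finally let the unit be an order unit of the group, and let v be a
    singular vertex. A weight is a homomorphism from the graph monoid to the
    integers, counting paths that lead to v at level -1; infinite emitters
    receive a surrogate value depending on a large parameter, so that a
    given element of the monoid has nonnegative weight once the parameter is
    large. The vertex v at level -1 has weight 1 while the unit has weight
    0, a contradiction ([not_group_unit]). *)

Set Implicit Arguments.
Unset Strict Implicit.
Unset Printing Implicit Defensive.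

Import Order.TTheory GRing.Theory Num.Theory.
Local Open Scope classical_set_scope.
Local Open Scope ring_scope.

(** * Propagation along the levels *)

Section Reach.
Variable E : digraph.

Fixpoint ends_path (n : nat) (w : vertex E) : Prop :=
  if n is n'.+1 then exists2 e, rng e = w & ends_path n' (src e) else True.

Lemma ends_pathW m n w : (m <= n)%N -> ends_path n w -> ends_path m w.
Proof.
elim: m n w => [|m IHm] [|n] w //= le_mn [e <- /(IHm _ _ le_mn)].
by exists e.
Qed.

(** The sets of ends of paths of length [n] decrease with [n] and the vertex
    set is finite, so they become constant: each vertex has its own bound,
    and a common bound is their maximum. *)
Lemma ends_path_stable :
  exists n, forall w, ends_path n w -> forall m, ends_path m w.
Proof.
have bound (w : vertex E) : exists n, ends_path n w -> forall m, ends_path m w.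
  have [[n nw]|all] := pselect (exists n, ~ ends_path n w).
    by exists n => /nw.
  exists 0%N => _ m; apply: contrapT => nm; by apply: all; exists m.
have [b bP] := choice bound.
exists (\max_w b w)%N => w en; apply: bP; apply: ends_pathW en.
exact: leq_bigmax.
Qed.

(** The combinatorial heart of both implications from the graph condition: a
    property of vertices at levels that is true at level 0, and that a
    vertex has exactly when all its out-neighbours have it one level up, is
    always true. Negative levels follow by unfolding upwards from level 0.
    For positive levels, it holds at level [n] at the end of every path of
    length [n]; a vertex unfolds along long enough paths into vertices that
    end paths of every length, hence satisfy the property at every level. *)
Lemma level_propagation (P : int -> vertex E -> Prop) :
  (forall v, P 0 v) ->
  (forall k e, P k (src e) -> P (k + 1) (rng e)) ->
  (forall k v, (forall e, src e = v -> P (k + 1) (rng e)) -> P k v) ->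
  forall k v, P k v.
Proof.
move=> P0 Pdown Pup.
have Pneg (n : nat) v : P (- n%:Z) v.
  elim: n v => [|n IHn] v; first exact: P0.
  apply: Pup => e _; have -> : - n.+1%:Z + 1 = - n%:Z by lia.
  exact: IHn.
have Pend (n : nat) w : ends_path n w -> P n%:Z w.
  elim: n w => [|n IHn] w; first by move=> _; apply: P0.
  move=> /= [e <- /IHn/Pdown]; by have -> : n%:Z + 1 = n.+1%:Z by lia.
have [N stableN] := ends_path_stable.
(* Unfolding any vertex along the paths of length N ends in vertices that end
   arbitrarily long paths. *)
have Pfrom (j m n : nat) v : (m + j)%N = N -> ends_path m v -> P n%:Z v.
  elim: j m n v => [|j IHj] m n v.
    by rewrite addn0 => -> /stableN/(_ n)/Pend.
  rewrite addnS -addSn => mjN emv; apply: Pup => e sev.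
  have -> : n%:Z + 1 = n.+1%:Z by lia.
  by apply: IHj mjN _; exists e; rewrite ?sev.
case=> [n|n] v; first exact: (Pfrom N 0%N).
by rewrite NegzE; apply: Pneg.
Qed.

End Reach.

(** * Modules over a Leavitt path algebra *)

Section Action.
Variables (K : fieldType) (E : digraph) (W : lmodType K).
Variable X : lpa_gen E -> W -> W.

(** A module over the Leavitt path algebra, given by its generators:
    operators on [W] that satisfy the defining relations. *)
Record leavitt_family : Prop := LeavittFamily {
  fam_linear g k u v : X g (k *: u + v) = k *: X g u + X g v;
  fam_vv v w : X (Vertex v) (X (Vertex v) w) = X (Vertex v) w;
  fam_vw u v w : u <> v -> X (Vertex u) (X (Vertex v) w) = 0;
  fam_src_edge e w : X (Vertex (src e)) (X (Edge e) w) = X (Edge e) w;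
  fam_edge_rng e w : X (Edge e) (X (Vertex (rng e)) w) = X (Edge e) w;
  fam_rng_ghost e w : X (Vertex (rng e)) (X (Ghost e) w) = X (Ghost e) w;
  fam_ghost_src e w : X (Ghost e) (X (Vertex (src e)) w) = X (Ghost e) w;
  fam_ghost_edge e w : X (Ghost e) (X (Edge e) w) = X (Vertex (rng e)) w;
  fam_ghost_edge_neq e f w : e <> f -> X (Ghost e) (X (Edge f) w) = 0;
  fam_regular v w : regular v ->
    X (Vertex v) w = \sum_(e <- fset_set (out v)) X (Edge e) (X (Ghost e) w) }.

Fixpoint expr_act (a : lpa_expr K E) (w : W) : W :=
  match a with
  | XGen g => X g w
  | XZero => 0
  | XAdd a b => expr_act a w + expr_act b w
  | XScale k a => k *: expr_act a w
  | XMul a b => expr_act a (expr_act b w)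
  end.

Hypothesis XP : leavitt_family.

Lemma expr_act_linear a k u v :
  expr_act a (k *: u + v) = k *: expr_act a u + expr_act a v.
Proof.
elim: a u v => [g||a IHa b IHb|l a IHa|a IHa b IHb] u v /=.
- exact: fam_linear.
- by rewrite scaler0 addr0.
- by rewrite IHa IHb scalerDr addrACA.
- by rewrite IHa scalerDr !scalerA mulrC.
- by rewrite IHb IHa.
Qed.

Lemma expr_act0 a : expr_act a 0 = 0.
Proof.
have := expr_act_linear a 1 0 0.
by rewrite !scale1r addr0 => /eqP; rewrite -subr_eq0 opprD addrA subrr add0r
  oppr_eq0 => /eqP.
Qed.

Lemma expr_actD a u v : expr_act a (u + v) = expr_act a u + expr_act a v.
Proof. by have := expr_act_linear a 1 u v; rewrite !scale1r. Qed.

Lemma expr_actZ a k u : expr_act a (k *: u) = k *: expr_act a u.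
Proof. by have := expr_act_linear a k u 0; rewrite !addr0 expr_act0 addr0. Qed.

(** The universal property of the presentation: it is what makes it possible
    to separate elements of the algebra. *)
Lemma expr_act_eq a b : lpa_eq a b -> forall w, expr_act a w = expr_act b w.
Proof.
elim=> {a b} /=.
- by [].
- by move=> a b _ ab w; rewrite ab.
- by move=> a b c _ ab _ bc w; rewrite ab.
- by move=> a a' b b' _ aa' _ bb' w; rewrite aa' bb'.
- by move=> k a a' _ aa' w; rewrite aa'.
- by move=> a a' b b' _ aa' _ bb' w; rewrite aa' bb'.
- by move=> a b c w; rewrite addrA.
- by move=> a b w; rewrite addrC.
- by move=> a w; rewrite add0r.
- by move=> k l a w; rewrite scalerA.
- by move=> a w; rewrite scale0r.
- by move=> a w; rewrite scale1r.
- by move=> k a b w; rewrite scalerDr.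
- by move=> k l a w; rewrite scalerDl.
- by [].
- by [].
- by move=> a b c w; rewrite expr_actD.
- by [].
- by move=> k a b w; rewrite expr_actZ.
- by move=> v w; apply: fam_vv.
- by move=> u v uv w; apply: fam_vw.
- by move=> e w; apply: fam_src_edge.
- by move=> e w; apply: fam_edge_rng.
- by move=> e w; apply: fam_rng_ghost.
- by move=> e w; apply: fam_ghost_src.
- by move=> e w; apply: fam_ghost_edge.
- by move=> e f ef w; apply: fam_ghost_edge_neq.
move=> v rv w; rewrite (fam_regular XP) //.
by elim/big_rec2: _ => //= e y1 y2 _ <-.
Qed.

Definition lpa_act (z : LPA K E) : W -> W := expr_act (repr z).

Lemma lpa_act_class a w : lpa_act (lpa_class a) w = expr_act a w.
Proof. exact/expr_act_eq/lpa_repr. Qed.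

Lemma lpa_actD y z w : lpa_act (y + z) w = lpa_act y w + lpa_act z w.
Proof.
elim/lpa_ind: y => a; elim/lpa_ind: z => b.
by rewrite -lpa_classD !lpa_act_class.
Qed.

Lemma lpa_actZ k z w : lpa_act (k *: z) w = k *: lpa_act z w.
Proof. by elim/lpa_ind: z => a; rewrite -lpa_classZ !lpa_act_class. Qed.

Lemma lpa_actM y z w : lpa_act (y * z) w = lpa_act y (lpa_act z w).
Proof.
elim/lpa_ind: y => a; elim/lpa_ind: z => b.
by rewrite -lpa_classM !lpa_act_class.
Qed.

Lemma lpa_act0 w : lpa_act 0 w = 0.
Proof. exact: (lpa_act_class (XZero K E)). Qed.

Lemma lpa_act_sum I (s : seq I) (f : I -> LPA K E) w :
  lpa_act (\sum_(i <- s) f i) w = \sum_(i <- s) lpa_act (f i) w.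
Proof. exact: (big_morph _ (fun y z => lpa_actD y z w) (lpa_act0 w)). Qed.

End Action.

(** * Vertices are nonzero *)

Section VertexNonzero.
Variables (K : fieldType) (E : digraph).

(** Streams encode the infinite paths, and the finite paths that end at a
    singular vertex, where [None] is read. A finite path has many encodings,
    one for each stream of values after [None]; they only enlarge the
    representation. *)
Definition stream := nat -> vertex E * option (edge E).

Definition boundary (p : stream) : Prop := forall n,
  if (p n).2 is Some e then src e = (p n).1 /\ rng e = (p n.+1).1
  else ~ regular (p n).1.

Definition tail (p : stream) : stream := fun n => p n.+1.

Definition prepend (e : edge E) (p : stream) : stream :=
  fun n => if n is n'.+1 then p n' else (src e, Some e).

Lemma boundary_tail p : boundary p -> boundary (tail p).
Proof. by move=> maxp n; apply: maxp. Qed.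

Lemma boundary_prepend e p : boundary p -> (p 0%N).1 = rng e ->
  boundary (prepend e p).
Proof. by move=> maxp pe [|n] /=; [|apply: maxp]. Qed.

Lemma prepend_tail e p : p 0%N = (src e, Some e) -> prepend e (tail p) = p.
Proof. by move=> pe; apply/funext => -[|n]. Qed.

(** From any vertex one follows chosen edges until a singular vertex, if
    any. *)
Lemma exists_boundary v : exists p, boundary p /\ (p 0%N).1 = v.
Proof.
have next u : exists o : option (edge E),
    if o is Some e then src e = u else ~ regular u.
  have [ru|nru] := pselect (regular u); last by exists None.
  by case: (ru.2) => e eu; exists (Some e).
have [nx nxP] := choice next.
pose step u := if nx u is Some e then rng e else u.
exists (fun n => (iter n step v, nx (iter n step v))); split=> // n /=.
by have := nxP (iter n step v); rewrite /step; case: (nx _).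
Qed.

(** The algebra acts on the functions on boundary paths (truncated to zero
    outside of them) because prepending [e] is a bijection from the boundary
    paths that start at [rng e] to those that begin with [e]. *)
Definition path_fun (g : lpa_gen E) (f : stream -> K^o) : stream -> K^o :=
  fun p => match g with
  | Vertex v => if `[< boundary p /\ (p 0%N).1 = v >] then f p else 0
  | Edge e =>
      if `[< boundary p /\ p 0%N = (src e, Some e) >] then f (tail p) else 0
  | Ghost e =>
      if `[< boundary p /\ (p 0%N).1 = rng e >] then f (prepend e p) else 0
  end.

Lemma path_fun_family : leavitt_family path_fun.
Proof.
split.
- move=> [v|e|e] k f f'; apply/funext => p;
    rewrite -[RHS]/(k * _ + _) /path_fun;
    by case: asboolP => _ //; rewrite mulr0 addr0.
- by move=> v f; apply/funext => p; rewrite /path_fun; case: asboolP.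
- move=> u v f uv; apply/funext => p; rewrite /path_fun.
  case: asboolP => // -[_ pu]; case: asboolP => // -[_ pv].
  by case: uv; rewrite -pu.
- move=> e f; apply/funext => p; rewrite /path_fun.
  case: asboolP => // nsrc; case: asboolP => // -[maxp pe]; case: nsrc.
  by rewrite pe.
- move=> e f; apply/funext => p; rewrite /path_fun.
  case: asboolP => // -[maxp pe]; case: asboolP => // -[].
  split; first exact: boundary_tail.
  by have := maxp 0%N; rewrite pe => -[_ <-].
- by move=> e f; apply/funext => p; rewrite /path_fun; case: asboolP.
- move=> e f; apply/funext => p; rewrite /path_fun.
  case: asboolP => // -[maxp pe]; case: asboolP => // -[].
  by split=> //; apply: boundary_prepend.
- move=> e f; apply/funext => p; rewrite /path_fun.
  case: asboolP => // -[maxp pe]; case: asboolP => [_|[]]; first exact: congr1.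
  by split=> //; apply: boundary_prepend.
- move=> e e' f ee'; apply/funext => p; rewrite /path_fun.
  by case: asboolP => // _; case: asboolP => // -[_ [_ /ee']].
move=> v f rv; rewrite fct_sumE; apply/funext => p; rewrite /path_fun.
have in_out e : (e \in fset_set (out v)) = `[< src e = v >].
  rewrite in_fset_set; last exact: rv.1.
  by apply/idP/asboolP => [/set_mem|/mem_set].
case: asboolP => [[maxp pv]|nmax]; last first.
  rewrite big_seq big1 // => e; rewrite in_out => /asboolP ev.
  by case: asboolP => // -[maxp pe]; case: nmax; rewrite pe.
(* A boundary path from a regular vertex has a first edge [e], which selects the
   only nonzero term of the sum. *)
have := maxp 0%N; case pe: (p 0%N).2 => [e|]; last by rewrite pv.
case=> se re; have p0 : p 0%N = (src e, Some e).
  by rewrite se -pe -surjective_pairing.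
rewrite (big_fsetD1 e) /=; last by rewrite in_out; apply/asboolP; rewrite se.
rewrite big_seq big1 ?addr0 => [|e'].
  case: asboolP => [_|[]] //; case: asboolP => [_|[]]; last first.
    by split=> //; apply: boundary_tail.
  by rewrite prepend_tail.
rewrite in_fsetD1 => /andP[/eqP e'e _]; case: asboolP => // -[_].
by rewrite p0 => -[_ /esym/e'e].
Qed.

(** Some boundary path starts at [v], so [v] does not kill the constant
    function 1: the relations do not make a vertex collapse. *)
Lemma lpa_v_neq0 (v : vertex E) : lpa_v K v <> 0.
Proof.
move=> v0; have [p [maxp pv]] := exists_boundary v.
have := lpa_act0 path_fun_family (fun=> 1); rewrite -v0 /lpa_v.
rewrite (lpa_act_class path_fun_family) /= => /(congr1 (@^~ p)) /eqP.
rewrite /path_fun; case: asboolP => [_|[]//].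
by apply/negP; rewrite -[X in _ != X]/(0 : K) oner_eq0.
Qed.

End VertexNonzero.

(** * The grading *)

Section Components.
Variables (K : fieldType) (E : digraph).
Implicit Types (u v w : vertex E) (e f : edge E) (s t : seq (edge E)).
Implicit Types (y z : LPA K E) (d : int).

Local Notation V := (@lpa_v K E).
Local Notation D := (@lpa_e K E).
Local Notation G := (@lpa_g K E).
Local Notation C := (@lpa_component K E).

Lemma lpa_vvE v w : V v * V w = if v == w then V v else 0.
Proof. exact: lpa_vertM. Qed.

Lemma lpa_src_edgeE e : V (src e) * D e = D e.
Proof. by rewrite /lpa_v /lpa_e -lpa_classM; apply/lpa_classP/lpa_src_edge. Qed.

Lemma lpa_edge_rngE e : D e * V (rng e) = D e.
Proof. by rewrite /lpa_v /lpa_e -lpa_classM; apply/lpa_classP/lpa_edge_rng. Qed.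

Lemma lpa_rng_ghostE e : V (rng e) * G e = G e.
Proof. by rewrite /lpa_v /lpa_g -lpa_classM; exact/lpa_classP/lpa_rng_ghost. Qed.

Lemma lpa_ghost_srcE e : G e * V (src e) = G e.
Proof. by rewrite /lpa_v /lpa_g -lpa_classM; apply/lpa_classP/lpa_ghost_src. Qed.

Lemma lpa_veE v e : V v * D e = if v == src e then D e else 0.
Proof.
rewrite -{1}[D e]lpa_src_edgeE mulrA lpa_vvE.
by case: eqP => [->|]; rewrite ?lpa_src_edgeE ?mul0r.
Qed.

Lemma lpa_gvE v e : G e * V v = if v == src e then G e else 0.
Proof.
rewrite -{1}[G e]lpa_ghost_srcE -mulrA lpa_vvE eq_sym.
by case: eqP => [_|]; rewrite ?lpa_ghost_srcE ?mulr0.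
Qed.

Lemma lpa_geE e f : G e * D f = if e == f then V (rng e) else 0.
Proof.
rewrite /lpa_v /lpa_e /lpa_g -lpa_classM.
case: eqP => [<-|ef]; apply/lpa_classP.
  exact: lpa_ghost_edge.
exact: lpa_ghost_edge_neq.
Qed.

Lemma lpa_regularE v : regular v ->
  V v = \sum_(e <- fset_set (out v)) D e * G e.
Proof.
move=> rv; transitivity (lpa_class
  (\big[@XAdd K E/@XZero K E]_(e <- fset_set (out v))
    XMul (XGen K (Edge e)) (XGen K (Ghost e)))).
  exact/lpa_classP/lpa_regular.
rewrite (big_morph (@lpa_class K E) (id1 := 0) (op1 := +%R)) //.
  by apply: eq_bigr => e _; apply: lpa_classM.
exact: lpa_classD.
Qed.

Definition real_prod s : LPA K E := \prod_(e <- s) D e.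
Definition ghost_prod s : LPA K E := \prod_(e <- rev s) G e.

Lemma real_prod_cons e s : real_prod (e :: s) = D e * real_prod s.
Proof. exact: big_cons. Qed.

Lemma real_prod_cat s t : real_prod (s ++ t) = real_prod s * real_prod t.
Proof. exact: big_cat. Qed.

Lemma ghost_prod_cat s t : ghost_prod (s ++ t) = ghost_prod t * ghost_prod s.
Proof. by rewrite /ghost_prod rev_cat big_cat. Qed.

Lemma ghost_prod1 e : ghost_prod [:: e] = G e.
Proof. exact: big_seq1. Qed.

Lemma ghost_prod_cons e s : ghost_prod (e :: s) = ghost_prod s * G e.
Proof. by rewrite -cat1s ghost_prod_cat ghost_prod1. Qed.

(** The monomial p q* with [p] of source [v] and edges [s], and [q] of
    source [w] and edges [t]. Arbitrary lists are allowed, since the product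
    is zero when they do not form paths; this spares all path side
    conditions below. *)
Definition mono v s t w : LPA K E :=
  V v * real_prod s * (ghost_prod t * V w).

Lemma real_prod_not_path v s : ~~ is_path v s -> V v * real_prod s = 0.
Proof.
elim: s v => [//|e s IHs] v /=; rewrite real_prod_cons mulrA lpa_veE eq_sym.
case: eqP => [_ /= nps|]; last by rewrite mul0r.
by rewrite -lpa_edge_rngE -mulrA IHs // mulr0.
Qed.

Lemma ghost_prod_not_path w t : ~~ is_path w t -> ghost_prod t * V w = 0.
Proof.
elim: t w => [//|e t IHt] w /=; rewrite ghost_prod_cons -mulrA lpa_gvE eq_sym.
case: eqP => [_ /= npt|]; last by rewrite mulr0.
by rewrite -lpa_rng_ghostE mulrA IHt // mul0r.
Qed.

Lemma comp0 d : C d 0.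
Proof. by exists [::] => //; rewrite big_nil. Qed.

Lemma compD d y z : C d y -> C d z -> C d (y + z).
Proof.
move=> [s sd ->] [t td ->]; exists (s ++ t); last by rewrite big_cat.
by move=> i; rewrite mem_cat => /orP[/sd|/td].
Qed.

Lemma compZ d k z : C d z -> C d (k *: z).
Proof.
move=> [s sd ->]; exists [seq (k * i.1, i.2) | i <- s].
  by move=> _ /mapP[i /sd id ->].
by rewrite big_map scaler_sumr; apply: eq_bigr => i _; rewrite scalerA.
Qed.

Lemma comp_sum d I (r : seq I) (P : pred I) (F : I -> LPA K E) :
  (forall i, P i -> C d (F i)) -> C d (\sum_(i <- r | P i) F i).
Proof. by move=> CF; elim/big_ind: _ => //; [apply: comp0|apply: compD]. Qed.

Lemma comp_mono d v s t w :
  (size s)%:Z - (size t)%:Z = d -> C d (mono v s t w).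
Proof.
move=> std; rewrite /mono.
have [ps|/real_prod_not_path->] := boolP (is_path v s); last first.
  by rewrite mul0r; apply: comp0.
have [pt|/ghost_prod_not_path->] := boolP (is_path w t); last first.
  by rewrite mulr0; apply: comp0.
exists [:: (1, (exist _ (v, s) ps : gpath E, exist _ (w, t) pt : gpath E))].
  by move=> i; rewrite inE => /eqP ->.
by rewrite big_seq1 /= scale1r.
Qed.

Lemma comp_rect d (P : LPA K E -> Prop) :
  P 0 -> (forall y z, P y -> P z -> P (y + z)) ->
  (forall k v s t w, (size s)%:Z - (size t)%:Z = d -> P (k *: mono v s t w)) ->
  forall z, C d z -> P z.
Proof.
move=> P0 PD Pm _ [l ld ->]; rewrite big_seq.
by elim/big_ind: _ => // -[k [p q]] /ld; apply: Pm.
Qed.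

(** Multiplying on the right by [w] tests whether the path ends at [w]. *)
Lemma real_prod_vertex v s w :
  V v * real_prod s * V w =
  if last v (map (@rng E) s) == w then V v * real_prod s else 0.
Proof.
elim: s v => [|e s IHs] v /=; first by rewrite /real_prod big_nil !mulr1 lpa_vvE.
rewrite real_prod_cons -lpa_edge_rngE !mulrA -!(mulrA (V v * D e)).
by rewrite IHs; case: eqP; rewrite ?mulr0.
Qed.

(** In p q* p' q'* the ghost edges of q* cancel against the edges of p' one
    by one, until a mismatch gives zero or one of the two is exhausted; each
    cancellation preserves the difference of the lengths. *)
Lemma comp_monoM d v s t w v' s' t' w' :
  (size s)%:Z - (size t)%:Z + ((size s')%:Z - (size t')%:Z) = d ->
  C d (mono v s t w * mono v' s' t' w').
Proof.
elim: t w v' s' => [|e t IHt] w v' s' sz; rewrite /mono.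
  rewrite /ghost_prod big_nil mul1r -/(ghost_prod t') !mulrA real_prod_vertex.
  case: eqP => [_|_]; last by rewrite !mul0r; apply: comp0.
  rewrite real_prod_vertex.
  case: eqP => [_|_]; last by rewrite !mul0r; apply: comp0.
  rewrite -(mulrA _ (real_prod s)) -real_prod_cat -(mulrA _ _ (V w')).
  apply: comp_mono.
  by rewrite size_cat; move: sz => /=; lia.
rewrite !mulrA -(mulrA _ (V w)) lpa_vvE.
case: eqP => [_|_]; last by rewrite mulr0 !mul0r; apply: comp0.
rewrite ghost_prod_cons mulrA -(mulrA _ (G e)) lpa_gvE.
case: eqP => [_|_]; last by rewrite mulr0 !mul0r; apply: comp0.
case: s' sz => [|f s'] sz.
  rewrite /real_prod big_nil mulr1 -/(real_prod s).
  rewrite -(mulrA _ _ (G e)) -ghost_prod_cons -(mulrA _ _ (ghost_prod t')).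
  rewrite -ghost_prod_cat -(mulrA _ _ (V w')); apply: comp_mono.
  by rewrite size_cat; move: sz => /=; lia.
rewrite real_prod_cons !mulrA -(mulrA _ (G e)) lpa_geE.
case: eqP => [_|_]; last by rewrite mulr0 !mul0r; apply: comp0.
have := IHt (rng e) (rng e) s'.
rewrite /mono !mulrA -(mulrA _ (V (rng e)) (V _)).
rewrite lpa_vvE eqxx; apply; move: sz => /=; lia.
Qed.

Lemma compM d d' y z : C d y -> C d' z -> C (d + d') (y * z).
Proof.
move=> Cy Cz; elim/comp_rect: y / Cy => [|y y' Cy Cy'|k v s t w sz].
- by rewrite mul0r; apply: comp0.
- by rewrite mulrDl; apply: compD.
elim/comp_rect: z / Cz => [|z z' Cz Cz'|k' v' s' t' w' sz'].
- by rewrite mulr0; apply: comp0.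
- by rewrite mulrDr; apply: compD.
rewrite -lpa_scalerAl -lpa_scalerAr; do 2![apply: compZ].
by apply: comp_monoM; rewrite sz sz'.
Qed.

Lemma comp_v v : C 0 (V v).
Proof.
suff -> : V v = mono v [::] [::] v by apply: comp_mono.
by rewrite /mono /real_prod /ghost_prod !big_nil mulr1 mul1r lpa_vvE eqxx.
Qed.

Lemma comp_e e : C 1 (D e).
Proof.
suff -> : D e = mono (src e) [:: e] [::] (rng e) by apply: comp_mono.
rewrite /mono real_prod_cons /real_prod /ghost_prod !big_nil mulr1 mul1r.
by rewrite lpa_src_edgeE lpa_edge_rngE.
Qed.

Lemma comp_g e : C (-1) (G e).
Proof.
suff -> : G e = mono (rng e) [::] [:: e] (src e) by apply: comp_mono.
rewrite /mono ghost_prod1 /real_prod big_nil mulr1.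
by rewrite lpa_ghost_srcE lpa_rng_ghostE.
Qed.

(** The sums of homogeneous elements contain the generators and are stable
    under the operations of the algebra. *)
Lemma lpa_spanned z :
  exists2 l : seq (int * LPA K E), {in l, forall i, C i.1 i.2} &
    z = \sum_(i <- l) i.2.
Proof.
pose Sp z := exists2 l : seq (int * LPA K E),
  {in l, forall i, C i.1 i.2} & z = \sum_(i <- l) i.2.
have Sp1 d y : C d y -> Sp y.
  move=> Cy; exists [:: (d, y)]; last by rewrite big_seq1.
  by move=> i; rewrite inE => /eqP ->.
have SpD y y' : Sp y -> Sp y' -> Sp (y + y').
  move=> [l lC ->] [l' lC' ->]; exists (l ++ l'); last by rewrite big_cat.
  by move=> i; rewrite mem_cat => /orP[/lC|/lC'].
have Sp0 : Sp 0 by exact: (Sp1 0 0 (comp0 0)).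
rewrite -/(Sp z); elim/lpa_ind: z.
elim=> [[v|e|e]||a IHa b IHb|k a IHa|a IHa b IHb].
- exact: Sp1 (comp_v v).
- exact: Sp1 (comp_e e).
- exact: Sp1 (comp_g e).
- exact: Sp0.
- by rewrite lpa_classD; apply: SpD.
- rewrite lpa_classZ; case: IHa => l lC ->; rewrite scaler_sumr big_seq.
  by elim/big_ind: _ => // i /lC Ci; apply/Sp1/compZ/Ci.
rewrite lpa_classM; case: IHa => l lC ->; case: IHb => l' lC' ->.
rewrite mulr_suml big_seq; elim/big_ind: _ => // i /lC Ci.
rewrite mulr_sumr big_seq; elim/big_ind: _ => // j /lC' Cj.
exact: Sp1 (compM Ci Cj).
Qed.

(** The grading as an action on the two-sided formal series in a variable
    [t] with coefficients in the algebra: a vertex [v] acts by [v], an edge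
    [e] by [e t] and its ghost by the ghost times 1/t. *)
Definition series_act (g : lpa_gen E) (h : int -> LPA K E) : int -> LPA K E :=
  fun m => match g with
  | Vertex v => V v * h m
  | Edge e => D e * h (m - 1)
  | Ghost e => G e * h (m + 1)
  end.

Lemma series_act_family : leavitt_family series_act.
Proof.
split.
- move=> g k h h'; apply/funext => m.
  rewrite -[RHS]/(k *: series_act g h m + series_act g h' m).
  have lin z y y' : z * (k *: y + y') = k *: (z * y) + z * y'.
    by rewrite mulrDr lpa_scalerAr.
  by case: g => i; apply: lin.
- by move=> v h; apply/funext => m; rewrite /series_act mulrA lpa_vvE eqxx.
- move=> u v h /eqP/negPf uv; apply/funext => m.
  by rewrite /series_act mulrA lpa_vvE uv mul0r.
- by move=> e h; apply/funext => m; rewrite /series_act mulrA lpa_src_edgeE.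
- by move=> e h; apply/funext => m; rewrite /series_act mulrA lpa_edge_rngE.
- by move=> e h; apply/funext => m; rewrite /series_act mulrA lpa_rng_ghostE.
- by move=> e h; apply/funext => m; rewrite /series_act mulrA lpa_ghost_srcE.
- move=> e h; apply/funext => m.
  by rewrite /series_act mulrA lpa_geE eqxx addrK.
- move=> e f h /eqP/negPf ef; apply/funext => m.
  by rewrite /series_act mulrA lpa_geE ef mul0r.
move=> v h rv; rewrite fct_sumE; apply/funext => m.
rewrite /series_act lpa_regularE // mulr_suml; apply: eq_bigr => e _.
by rewrite mulrA subrK.
Qed.

(** [z] acts as [z] times the [d]th power of the variable. *)
Definition homog d z := forall h m, lpa_act series_act z h m = z * h (m - d).

Lemma homog_v v : homog 0 (V v).
Proof. by move=> h m; rewrite (lpa_act_class series_act_family) /= subr0. Qed.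

Lemma homog_e e : homog 1 (D e).
Proof. by move=> h m; rewrite (lpa_act_class series_act_family). Qed.

Lemma homog_g e : homog (-1) (G e).
Proof. by move=> h m; rewrite (lpa_act_class series_act_family) /= opprK. Qed.

Lemma homogM d d' y z : homog d y -> homog d' z -> homog (d + d') (y * z).
Proof.
move=> hy hz h m; rewrite (lpa_actM series_act_family) hy hz mulrA.
by congr (_ * h _); rewrite opprD addrA.
Qed.

Lemma homog1 : homog 0 1.
Proof.
move=> h m; rewrite (lpa_act_sum series_act_family) fct_sumE.
rewrite mul1r -[RHS]mul1r mulr_suml.
by apply: eq_bigr => v _; rewrite homog_v.
Qed.

Lemma comp_homog d z : C d z -> homog d z.
Proof.
elim/comp_rect: z / => [|y z hy hz|k v s t w sz].
- by move=> h m; rewrite (lpa_act0 series_act_family) mul0r.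
- by move=> h m; rewrite (lpa_actD series_act_family) mulrDl -hy -hz.
move=> h m; rewrite (lpa_actZ series_act_family) -lpa_scalerAl; congr (_ *: _).
have hr : homog (size s)%:Z (real_prod s).
  elim: s {sz} => [|e s IHs];
    first by rewrite /real_prod big_nil; apply: homog1.
  rewrite real_prod_cons; have -> : (size (e :: s))%:Z = 1 + (size s)%:Z by [].
  exact: homogM (homog_e e) IHs.
have hg : homog (- (size t)%:Z) (ghost_prod t).
  elim: t {sz} => [|e t IHt];
    first by rewrite /ghost_prod big_nil; apply: homog1.
  rewrite ghost_prod_cons.
  have -> : - (size (e :: t))%:Z = - (size t)%:Z + - 1 by rewrite /=; lia.
  exact: homogM IHt (homog_g e).
rewrite -sz; have := homogM (homogM (homog_v v) hr) (homogM hg (homog_v w)).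
by rewrite add0r addr0 => ->.
Qed.

(** The sum of the components is direct because applying a sum of
    homogeneous elements to the constant series 1 displays the terms, with
    the element of degree [d] as the coefficient at [d]. *)
Lemma comp_graded : graded C.
Proof.
split.
- move=> d; split=> [|y z Cy Cz]; first exact: comp0.
  by rewrite -scaleN1r; apply/compD/compZ.
- move=> d d' _ [l lC ->]; rewrite big_seq; apply: comp_sum => i /lC[].
  exact: compM.
- move=> z; have [l lC ->] := lpa_spanned z.
  exists (undup (map fst l)), (fun d => \sum_(i <- l | i.1 == d) i.2); split.
    move=> d; rewrite big_seq_cond; apply: comp_sum => i /andP[/lC Ci /eqP <-].
    exact: Ci.
  under [RHS]eq_bigr do rewrite big_mkcond.
  rewrite exchange_big /= big_seq [RHS]big_seq; apply: eq_bigr => i il.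
  rewrite (bigD1_seq i.1) ?undup_uniq ?mem_undup ?map_f //= eqxx.
  by rewrite big1 ?addr0 // => d /negPf di; rewrite eq_sym di.
move=> s f us Cf sum0 d ds.
pose unit0 (m : int) : LPA K E := if m == 0 then 1 else 0.
have := congr1 (fun z => lpa_act series_act z unit0 d) sum0.
rewrite (lpa_act0 series_act_family) (lpa_act_sum series_act_family) fct_sumE.
rewrite (bigD1_seq d) //= (comp_homog (Cf d)) /unit0 subrr eqxx mulr1.
rewrite big1 ?addr0 // => d' d'd; rewrite (comp_homog (Cf d')) subr_eq0 eq_sym.
by rewrite (negPf d'd) mulr0.
Qed.

End Components.

(** * Strong grading *)

Section StronglyGraded.
Variables (K : fieldType) (E : digraph).

Local Notation V := (@lpa_v K E).
Local Notation D := (@lpa_e K E).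
Local Notation G := (@lpa_g K E).
Local Notation C := (@lpa_component K E).

Lemma prod_setD (R : pzRingType) (A B : set R) y z :
  prod_set A B y -> prod_set A B z -> prod_set A B (y + z).
Proof.
move=> [s sAB ->] [t tAB ->]; exists (s ++ t); last by rewrite big_cat.
by move=> i; rewrite mem_cat => /orP[/sAB|/tAB].
Qed.

Lemma prod_set_sum (R : pzRingType) (A B : set R) I (r : seq I) (P : pred I)
  (F : I -> R) :
  (forall i, P i -> prod_set A B (F i)) ->
  prod_set A B (\sum_(i <- r | P i) F i).
Proof.
move=> ABF; elim/big_ind: _ => //; last exact: prod_setD.
by exists [::]; rewrite ?big_nil.
Qed.

Lemma prod_set_sandwich (R : pzRingType) (A B A' B' : set R) a b z :
  (forall y, A y -> A' (a * y)) -> (forall y, B y -> B' (y * b)) ->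
  prod_set A B z -> prod_set A' B' (a * z * b).
Proof.
move=> Aa Bb [s sAB ->]; exists [seq (a * i.1, i.2 * b) | i <- s].
  by move=> _ /mapP[i /sAB[Ai Bi] ->]; split; [apply: Aa|apply: Bb].
by rewrite big_map mulr_sumr mulr_suml; apply: eq_bigr => i _; rewrite !mulrA.
Qed.

(** At level 0 this is [v = v v]. It passes down an edge [e] by sandwiching
    between the ghost of [e] and [e], and it passes up by the relation
    expressing a regular vertex as a sum of products of an edge and its
    ghost, hence it holds at all levels. *)
Lemma vertex_prod_set (k : int) v :
  row_finite E -> (forall w : vertex E, ~ sink w) ->
  prod_set (C (- k)) (C k) (V v).
Proof.
move=> rf nosink.
move: k v; apply: level_propagation => [v|k e|k v].
- exists [:: (V v, V v)]; last by rewrite big_seq1 lpa_vvE eqxx.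
  by move=> i; rewrite inE => /eqP ->; rewrite oppr0; split; apply: comp_v.
- have -> : V (rng e) = G e * V (src e) * D e.
    by rewrite lpa_ghost_srcE lpa_geE eqxx.
  apply: prod_set_sandwich => y Cy.
    by rewrite opprD addrC; apply: compM => //; apply: comp_g.
  by apply: compM => //; apply: comp_e.
move=> Pout; rewrite lpa_regularE; last first.
  by split; [apply: rf|apply/set0P/eqP/nosink].
rewrite big_seq; apply: prod_set_sum => e.
rewrite in_fset_set; last exact: rf.
rewrite inE -[D e * _](congr1 ( *%R^~ _) (lpa_edge_rngE K e)) => /Pout.
apply: prod_set_sandwich => y Cy.
  have -> : - k = 1 + - (k + 1) by lia.
  by apply: compM => //; apply: comp_e.
have -> : k = k + 1 + - 1 by lia.
by apply: compM => //; apply: comp_g.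
Qed.

(** The unit is the sum of the vertices, so it is a sum of products of
    elements of degrees [d] and [-d]; this factors any element of degree [d
    + d']. *)
Lemma strongly_graded_of_row_finite :
  row_finite E -> (forall w : vertex E, ~ sink w) -> strongly_graded C.
Proof.
move=> rf nosink; split=> [|d d']; first exact: comp_graded.
rewrite eqEsubset; split; first by case: (comp_graded K E).
move=> z Cz; rewrite -[z]mul1r mulr_suml; apply: prod_set_sum => v _.
rewrite -[V v]mul1r; apply:
  prod_set_sandwich (vertex_prod_set (- d) v rf nosink).
  by rewrite opprK => y Cy; rewrite mul1r.
by move=> y Cy; rewrite -[d'](addKr d); apply: compM.
Qed.

(** A monomial of positive degree starts with a real edge. *)
Lemma pos_comp_rect d (P : LPA K E -> Prop) : (0 < d)%R ->
  P 0 -> (forall y z, P y -> P z -> P (y + z)) ->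
  (forall e y, P (D e * y)) -> forall z, C d z -> P z.
Proof.
move=> d0 P0 PD Pe z; elim/comp_rect => // k w [|e s] t u sz.
  by move: sz d0 => /=; lia.
rewrite /mono real_prod_cons !mulrA lpa_veE.
case: eqP => _; last by rewrite !mul0r scaler0.
by rewrite -!mulrA lpa_scalerAr; apply: Pe.
Qed.

Lemma sink_pos_comp v d z : (0 < d)%R -> sink v -> C d z -> V v * z = 0.
Proof.
move=> d0 sv; move: z.
apply: (pos_comp_rect (P := fun z => V v * z = 0) d0) => [|y y' y0 y'0|e y].
- by rewrite mulr0.
- by rewrite mulrDr y0 y'0 addr0.
rewrite mulrA lpa_veE; case: eqP => [ve|_]; last by rewrite mul0r.
by have : out v e by []; rewrite sv.
Qed.

Lemma ghost_pos_comp d z : (0 < d)%R -> C d z ->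
  exists F : seq (edge E), forall e, e \notin F -> G e * z = 0.
Proof.
pose killed z := exists F : seq (edge E), forall e, e \notin F -> G e * z = 0.
move=> d0; move: z.
apply: (pos_comp_rect (P := killed) d0) => [|y y' [F Fy] [F' F'y']|f y].
- by exists [::] => e _; rewrite mulr0.
- exists (F ++ F') => e; rewrite mem_cat negb_or => /andP[/Fy y0 /F'y' y'0].
  by rewrite mulrDr y0 y'0 addr0.
by exists [:: f] => e; rewrite inE mulrA lpa_geE => /negPf ->; rewrite mul0r.
Qed.

(** Every vertex is a sum of products of elements of degrees 1 and -1. The
    finitely many left factors start with finitely many edges: a sink kills
    them all, and the ghost of one of the remaining edges of an infinite
    emitter does too. In the first case [v] vanishes, in the second the
    range of that edge. *)
Lemma row_finite_of_strongly_graded :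
  strongly_graded C -> row_finite E /\ forall w : vertex E, ~ sink w.
Proof.
case=> _ /(_ 1 (-1)) prodC.
have fact v : prod_set (C 1) (C (-1)) (V v).
  by rewrite prodC subrr; apply: comp_v.
split=> v; last first.
  move=> sv; apply: (@lpa_v_neq0 K E v); have [s sC vs] := fact v.
  have -> : V v = V v * V v by rewrite lpa_vvE eqxx.
  rewrite {2}vs mulr_sumr big_seq big1 // => i /sC[Ci _].
  by rewrite mulrA (sink_pos_comp _ sv Ci) ?mul0r.
apply: contrapT => infv; have [s sC vs] := fact v.
have [F FP] : exists F : seq (edge E), forall e, e \notin F ->
    forall i, i \in s -> G e * i.1 = 0.
  elim: s sC {vs} => [|i s IHs] sC; first by exists [::].
  have [j js|F FP] := IHs; first by apply: sC; rewrite inE js orbT.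
  have [|F' F'P] := @ghost_pos_comp 1 i.1 isT.
    by case: (sC i (mem_head _ _)).
  exists (F' ++ F) => e; rewrite mem_cat negb_or => /andP[/F'P Fi /FP Fs] j.
  by rewrite inE => /predU1P[->|/Fs].
have [e [ve eF]] : exists e, out v e /\ e \notin F.
  apply: contrapT => nex; apply/infv/(sub_finite_set _ (finite_seq F)) => e ve.
  by apply: contrapT => eF; apply: nex; exists e; split=> //; apply/negP.
apply: (@lpa_v_neq0 K E (rng e)).
have -> : V (rng e) = G e * V v * D e.
  by rewrite lpa_gvE -[v]ve eqxx lpa_geE eqxx.
rewrite vs mulr_sumr big_seq big1 ?mul0r // => i is_; rewrite mulrA (FP e) //.
by rewrite mul0r.
Qed.

End StronglyGraded.

(** * Levels and the free monoid *)

Section InfiniteCyclic.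
Variables (Gam : groupType) (x : Gam).
Hypothesis x_gen : infinite_cyclic x.

(** Powers of the generator; together with [zlog] they identify the group
    with the integers, the element [x] acting by raising the level by 1. *)
Definition zpow (k : int) : Gam :=
  match k with Posz n => (x ^+ n)%g | Negz n => (x ^- n.+1)%g end.

Lemma zpowS k : zpow (k + 1) = (zpow k * x)%g.
Proof.
case: k => [n|[|n]].
- by rewrite -PoszD addn1 /= expgSr.
- by rewrite /= mulVg.
rewrite NegzE; have -> : - n.+2%:Z + 1 = Negz n by lia.
by rewrite /= (expgS x n.+1) invgM mulgVK.
Qed.

Lemma zpow_inj : injective zpow.
Proof.
have zpowD k n : zpow (k + n%:Z) = (zpow k * x ^+ n)%g.
  elim: n => [|n IHn]; first by rewrite addr0 mulg1.
  by rewrite -addn1 PoszD addrA zpowS IHn addn1 expgSr mulgA.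
have le_inj k l : k <= l -> zpow k = zpow l -> k = l.
  move=> le_kl; have -> : l = k + `|l - k|%N%:Z by lia.
  case: `|_|%N => [|n]; first by rewrite addr0.
  rewrite zpowD -[in LHS](mulg1 (zpow k)) => /mulgI/esym xn1.
  by case: (x_gen.2 n.+1).
move=> k l kl; have [le_kl|/ltW le_lk] := leP k l; first exact: le_inj.
by apply/esym/le_inj.
Qed.

Lemma zpow_surj g : exists k, g = zpow k.
Proof.
have [[|n] [->|->]] := x_gen.1 g; [by exists 0| |by exists n.+1%:Z|].
  by exists 0; rewrite /= invg1.
by exists (Negz n).
Qed.

Definition zlog (g : Gam) : int := projT1 (cid (zpow_surj g)).

Lemma zlogK : cancel zlog zpow.
Proof. by move=> g; rewrite -(projT2 (cid (zpow_surj g))). Qed.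

Lemma zlogS g : zlog (g * x)%g = zlog g + 1.
Proof. by apply: zpow_inj; rewrite zpowS !zlogK. Qed.

Lemma zlog1 : zlog 1%g = 0.
Proof. by apply: zpow_inj; rewrite zlogK. Qed.

End InfiniteCyclic.

Section FreeMonoid.
Variables (Gam : groupType) (x : Gam) (E : digraph).
Local Notation FM := (FM Gam E).

Definition FM1 (t : Gam * fgen E) : FM := [mset t]%mset.

Lemma FM_rect (P : FM -> Prop) :
  P 0 -> (forall t a, P a -> P (FM1 t + a)) -> forall a, P a.
Proof.
move=> P0 PD a; rewrite -[a]seq_mset_id.
elim: (X in seq_mset X) => [|t s IHs].
  suff -> : seq_mset [::] = 0 :> FM by [].
  by apply/msetP => t; rewrite mset_seqE mset0E.
by rewrite mset_cons; apply: PD.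
Qed.

Section Extension.
Variables (A : nmodType) (h : Gam * fgen E -> A).

Definition FM_ext (a : FM) : A := \sum_(t <- enum_mset a) h t.

Lemma FM_extD a b : FM_ext (a + b) = FM_ext a + FM_ext b.
Proof.
rewrite /FM_ext -big_cat; apply: perm_big; apply/allP => t _ /=.
by rewrite count_cat !count_mem_mset msetE2.
Qed.

Lemma FM_ext0 : FM_ext 0 = 0.
Proof. by rewrite /FM_ext [enum_mset _]enum_mset0 big_nil. Qed.

Lemma FM_ext1 t : FM_ext (FM1 t) = h t.
Proof. by rewrite /FM_ext enum_msetn big_seq1. Qed.

Lemma FM_ext_sum I (r : seq I) (F : I -> FM) :
  FM_ext (\sum_(i <- r) F i) = \sum_(i <- r) FM_ext (F i).
Proof. exact: (big_morph _ FM_extD FM_ext0). Qed.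

End Extension.

Lemma ME_class_sum I (r : seq I) (P : pred I) (F : I -> FM) :
  ME_class x (\sum_(i <- r | P i) F i) = \sum_(i <- r | P i) ME_class x (F i).
Proof. exact: (big_morph _ (@ME_classD Gam x E) (erefl _)). Qed.

End FreeMonoid.

(** * A singular vertex excludes an order unit *)

Lemma groth_posD (N : nmodType) (p q : N) :
  groth_pos (p + q) = groth_pos p + groth_pos q.
Proof. by rewrite /groth_pos groth_pairD addr0. Qed.

Lemma groth_posMn (N : nmodType) (p : N) n :
  groth_pos (p *+ n) = groth_pos p *+ n.
Proof. by elim: n => [|n IHn]; rewrite ?mulr0n // !mulrS groth_posD IHn. Qed.

Section Weight.
Variables (Gam : groupType) (x : Gam) (E : digraph) (v0 : vertex E).
Hypothesis x_gen : infinite_cyclic x.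
Hypothesis v0_singular : ~ regular v0.

(** At a vertex [w] of level [-1 - i], the number of paths of length [i]
    from [w] to [v0] when all emitters on the way are finite. For an
    infinite emitter that number is replaced by a multiple, by the large
    parameter [n], of the sum of all values one level up: it is at least the
    sum over the ranges of any [n] of its edges. *)
Fixpoint path_count (n i : nat) (w : vertex E) : nat :=
  if i is i'.+1 then
    if `[< finite_set (out w) >]
    then (\sum_(e <- fset_set (out w)) path_count n i' (rng e))%N
    else (n * \sum_u path_count n i' u)%N
  else (w == v0).

(** Zero at all levels from 0 on, so that the classes of the vertices at
    level 0 have weight 0. *)
Definition level_weight (n : nat) (k : int) (w : vertex E) : int :=
  if k is Negz i then (path_count n i w)%:Z else 0.

(** At level -1 this says that the weight of [w] is 0, which is true because
    [v0] is singular, hence distinct from the regular vertex [w]. *)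
Lemma level_weight_regular n k w : regular w ->
  level_weight n k w =
    \sum_(e <- fset_set (out w)) level_weight n (k + 1) (rng e).
Proof.
move=> rw; case: k => [m|[|i]].
- by rewrite -PoszD big1.
- rewrite big1 //=; case: eqP => // wv0.
  by case: v0_singular; rewrite -wv0.
have -> : Negz i.+1 + 1 = Negz i by lia.
rewrite /=; case: asboolP => [_|[]]; last exact: rw.1.
exact: (big_morph Posz PoszD).
Qed.

(** The weight of [q_Z] is dictated by the relation (A2); it is an integer
    that may be negative for small [n]. *)
Definition gen_weight (n : nat) (t : Gam * fgen E) : int :=
  match t.2 with
  | inl w => level_weight n (zlog x_gen t.1) w
  | inr (existT w Z) => level_weight n (zlog x_gen t.1) w -
      \sum_(e <- val Z) level_weight n (zlog x_gen t.1 + 1) (rng e)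
  end.

Lemma gen_weight_ge0 t : exists N, forall n, (N <= n)%N -> 0 <= gen_weight n t.
Proof.
have ge0 n k w : 0 <= level_weight n k w by case: k.
case: t => g [w|[w [Z Zw]]]; first by exists 0%N => n _; apply: ge0.
have [infw _ _] := asboolP _ Zw.
exists #|` Z| => n leZn; rewrite /gen_weight /=.
case: (zlog _ g) => [m|[|i]].
- by rewrite -PoszD /level_weight big1 // subrr.
- by rewrite big1 ?subr0.
have -> : Negz i.+1 + 1 = Negz i by lia.
rewrite /=; case: asboolP => [//|_].
rewrite -(big_morph Posz PoszD (erefl _)) subr_ge0 lez_nat.
apply: leq_trans (leq_mul leZn (leqnn _)).
rewrite -sum1_size big_distrl /=; apply: leq_sum => e _.
by rewrite mul1n (bigD1 (rng e)) //= leq_addr.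
Qed.

Definition FM_weight n := FM_ext (gen_weight n).

Lemma FM_weight_ge0 a : exists N, forall n, (N <= n)%N -> 0 <= FM_weight n a.
Proof.
elim/FM_rect: a => [|t a [N Na]].
  by exists 0%N => n _; rewrite /FM_weight FM_ext0.
have [M Mt] := gen_weight_ge0 t; exists (maxn M N) => n.
rewrite geq_max => /andP[/Mt t0 /Na a0].
by rewrite /FM_weight FM_extD FM_ext1; apply: addr_ge0.
Qed.

Lemma FM_weight_v n g w :
  FM_weight n (Fv g w) = level_weight n (zlog x_gen g) w.
Proof. exact: FM_ext1. Qed.

Lemma FM_weight_q n g w (Z : qset w) :
  FM_weight n (Fq g Z) = level_weight n (zlog x_gen g) w -
      \sum_(e <- val Z) level_weight n (zlog x_gen g + 1) (rng e).
Proof. exact: FM_ext1. Qed.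

Lemma FM_weight_sum n g (r : seq (edge E)) :
  FM_weight n (\sum_(e <- r) Fv (g * x)%g (rng e)) =
  \sum_(e <- r) level_weight n (zlog x_gen g + 1) (rng e).
Proof.
rewrite /FM_weight FM_ext_sum; apply: eq_bigr => e _.
by rewrite -zlogS -FM_weight_v.
Qed.

Lemma FM_weight_step n a b : FM_step x a b -> FM_weight n a = FM_weight n b.
Proof.
have weightD := FM_extD (gen_weight n).
case=> [c g v rv|c g v Z|c g v Z W ZW];
  rewrite /FM_weight !weightD -/(FM_weight n).
- by rewrite FM_weight_v FM_weight_sum level_weight_regular.
- by rewrite FM_weight_v FM_weight_q FM_weight_sum -addrA subrK.
rewrite !FM_weight_q FM_weight_sum -addrA; congr (_ + _).
rewrite -addrA; congr (_ + _).
rewrite [X in _ = - X + _](big_fsetID _ (mem (val Z))) /=.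
have -> : [fset e in val W | e \in val Z]%fset = val Z.
  apply/fsetP => e; rewrite !inE andbC; case: (boolP (e \in val Z)) => //= eZ.
  exact: (fsubsetP (fproper_sub ZW)).
have -> : [fset e in val W | e \notin val Z]%fset = (val W `\` val Z)%fset.
  by apply/fsetP => e; rewrite !inE andbC.
by rewrite opprD subrK.
Qed.

Definition ME_weight n (m : ME x E) : int := FM_weight n (repr m).

Lemma ME_weight_class n a : ME_weight n (ME_class x a) = FM_weight n a.
Proof.
have weight_eq b c : clos_refl_sym_trans _ (@FM_step Gam x E) b c ->
    FM_weight n b = FM_weight n c.
  by elim=> {b c} [b c /FM_weight_step->|b|b c _ ->|b c d _ -> _ ->].
exact/weight_eq/ME_repr.
Qed.

Lemma ME_weightD n m m' : ME_weight n (m + m') = ME_weight n m + ME_weight n m'.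
Proof.
elim/ME_ind: m => a; elim/ME_ind: m' => b.
by rewrite -ME_classD !ME_weight_class; apply: FM_extD.
Qed.

Lemma ME_weight_one n : ME_weight n (ME_one x E) = 0.
Proof.
rewrite /ME_one -ME_class_sum ME_weight_class.
rewrite /FM_weight FM_ext_sum big1 // => v _.
by rewrite -/(FM_weight n _) FM_weight_v zlog1.
Qed.

(** Translated to level -1, the singular vertex [v0] has weight 1, whereas
    the multiples of the order unit have weight 0 and any given element of
    the positive cone has nonnegative weight for large [n]. The weights take
    values in a group, so the argument passes to the group completion. *)
Lemma not_group_unit : ~ group_strong_order_unit (@GE_le Gam x E) (GE_one x E).
Proof.
case=> _ /(_ (groth_pos (ME_class x (Fv x^-1 v0))%g)) [N _ [m]].
rewrite /GE_one -groth_posMn => /(canRL (subrK _)).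
rewrite -groth_posD => /groth_pairP[c].
rewrite !addr0; elim/ME_ind: m => a eqc.
have [M /(_ _ (leqnn M)) Ma] := FM_weight_ge0 a.
have := congr1 (ME_weight M) eqc; rewrite !ME_weightD => /addIr.
rewrite !ME_weight_class FM_weight_v.
have -> : zlog x_gen x^-1%g = Negz 0.
  by apply: (addIr 1); rewrite -zlogS mulVg zlog1.
have -> : ME_weight M (ME_one x E *+ N) = 0.
  elim: N {eqc} => [|N IHN]; last by rewrite mulrS ME_weightD ME_weight_one IHN.
  by rewrite mulr0n; apply: etrans (ME_weight_class _ _) (FM_ext0 _).
by move=> /=; rewrite eqxx; lia.
Qed.

End Weight.

(** * The order unit of a row-finite graph without sinks *)

Section Monoid.
Variables (Gam : groupType) (x : Gam) (E : digraph).
Hypothesis x_gen : infinite_cyclic x.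

Definition bounded (m : ME x E) : Prop :=
  exists2 n, (0 < n)%N & ME_le m (ME_one x E *+ n).

Lemma boundedD m m' : bounded m -> bounded m' -> bounded (m + m').
Proof.
move=> [n n0 [c mc]] [n' _ [c' mc']]; exists (n + n')%N.
  by rewrite addn_gt0 n0.
by exists (c + c'); rewrite addrACA mc mc' mulrnDr.
Qed.

Lemma boundedW m m' : bounded (m + m') -> bounded m.
Proof.
by move=> [n n0 [c mc]]; exists n => //; exists (m' + c); rewrite addrA.
Qed.

Lemma bounded0 : bounded 0.
Proof. by exists 1%N => //; exists (ME_one x E); rewrite add0r. Qed.

Hypothesis rf : row_finite E.
Hypothesis nosink : forall v : vertex E, ~ sink v.

Lemma ME_expand g (v : vertex E) : ME_class x (Fv g v) =
  \sum_(e <- fset_set (out v)) ME_class x (Fv (g * x)%g (rng e)).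
Proof.
rewrite -ME_class_sum; apply/ME_classP/rst_step.
rewrite -[X in FM_step _ X]add0r -[X in FM_step _ _ X]add0r; apply: FM_A1.
by split; [apply: rf|apply/set0P/eqP/nosink].
Qed.

(** At level 0 a vertex is a summand of the unit; the expansion of a vertex
    into its out-neighbours one level up transfers boundedness in both
    directions. *)
Lemma bounded_vertex k (v : vertex E) : bounded (ME_class x (Fv (zpow x k) v)).
Proof.
have in_out (w : vertex E) e : (e \in fset_set (out w)) = (e \in out w).
  by rewrite in_fset_set //; apply: rf.
move: k v; apply: level_propagation => [v|k e|k v] /=.
- exists 1%N => //; rewrite mulr1n /ME_one (bigD1 v) //=.
  by eexists; reflexivity.
- rewrite ME_expand -zpowS (big_fsetD1 e) /=; first exact: boundedW.
  by rewrite in_out inE.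
move=> bout; rewrite ME_expand -zpowS big_seq.
elim/big_ind: _ => [|m m'|e]; [exact: bounded0|exact: boundedD|].
by rewrite in_out inE => /bout.
Qed.

(** Without infinite emitters there are no generators [q_Z], so the
    translates of the vertices generate the monoid. *)
Lemma monoid_unit : strong_order_unit (@ME_le Gam x E) (ME_one x E).
Proof.
elim/ME_ind => a; rewrite -/(bounded _).
elim/FM_rect: a => [|[g [v|[v [Z Zv]]]] a IHa]; first exact: bounded0.
  rewrite ME_classD; apply: boundedD IHa.
  by rewrite -[g](zlogK x_gen); apply: bounded_vertex.
by have [infv] := asboolP _ Zv; case: infv; apply: rf.
Qed.

End Monoid.

Lemma group_unit_of_monoid_unit (Gam : groupType) (x : Gam) (E : digraph) :
  strong_order_unit (@ME_le Gam x E) (ME_one x E) ->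
  group_strong_order_unit (@GE_le Gam x E) (GE_one x E).
Proof.
move=> unitM; split; first by exists (ME_one x E); rewrite subr0.
elim/groth_ind => m m'; have [n n0 [c mc]] := unitM m; exists n => //.
exists (c + m'); rewrite /GE_one -groth_posMn -mc groth_pairN groth_pairD.
apply/groth_pairP; exists 0.
by rewrite !addr0 add0r -addrA addrC.
Qed.

(** * The equivalence *)

Theorem theorem5p1 (E : digraph) (K : fieldType) (Gam : groupType) (x : Gam)
  (x_gen : infinite_cyclic x) :
  [<-> strongly_graded (@lpa_component K E);
       strong_order_unit (@ME_le Gam x E) (ME_one x E);
       group_strong_order_unit (@GE_le Gam x E) (GE_one x E);
       row_finite E /\ forall v : vertex E, ~ sink v].
Proof.
tfae.
- by move=> /row_finite_of_strongly_graded[]; apply: monoid_unit.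
- exact: group_unit_of_monoid_unit.
- move=> unitG; have reg (v : vertex E) : regular v.
    by apply: contrapT => /(not_group_unit x_gen)/(_ unitG).
  split=> v; first exact: (reg v).1.
  by case: (reg v) => _ /set0P/eqP.
- by case; apply: strongly_graded_of_row_finite.
Qed.
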